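(* Let $f,g_1,\dots,g_s\in\mathbb{R}[x_1,\dots,x_n]$, and let $A$, $A_i$, $\Delta(A)$, $\alpha(0),\dots,\alpha(r)$, $G(\mu)$, $\Delta(G)$, $G(\mu)_{\rm sonc}$, $s(f,\mathbf g)$ and the optimization problems (P) and (Q) be as defined in the context. Assume that for every $1\le j\le r$ the form $G(\mu)_{\alpha(j)}=-\sum_{i=0}^s\mu_ig_{i,\alpha(j)}$ has exactly one strictly positive term, i.e. there exists exactly one strictly negative $g_{i,\alpha(j)}$ ($0\le i\le s$). Assume furthermore that $g_{i,\alpha(0)}\ge0$ for all $i=1,\dots,s$, and that $\Delta(A)\cap A_i\cap A_l=\emptyset$ for all $0\le i<l\le s$. Let $\gamma$ be the optimal value of (P) and $\gamma_{\rm sonc}$ the optimal value of (Q). If the optimal value $s(f,\mathbf g)=\sup\{G(\mu)_{\rm sonc}:\mu\in\mathbb{R}_{\ge0}^s\}$ is attained for some $\mu\in(0,\infty)^s$, then $$f_{\alpha(0)}-\gamma_{\rm sonc}\ =\ f_{\alpha(0)}-\gamma\ =\ s(f,\mathbf g),$$ where $f_{\alpha(0)}$ is the coefficient of $x^{\alpha(0)}$ in $f$.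
   Context: Setting. Let $f,g_1,\dots,g_s\in\mathbb{R}[x_1,\dots,x_n]$, $g_0=-f$, $\mu_0=1$, and for $\mu=(\mu_1,\dots,\mu_s)\in\mathbb{R}_{\ge0}^s$ let $G(\mu)(x)=f(x)-\sum_{i=1}^s\mu_ig_i(x)=-\sum_{i=0}^s\mu_ig_i(x)$. Let $A_i\subset\mathbb{N}^n$ be the support of $g_i$ and $A=\bigcup_{i=0}^sA_i$. Let $V(A)$ be the vertex set of $\mathrm{conv}(A)$. Standing assumption: $V(A)=\{\alpha(0),\dots,\alpha(r)\}$ consists of affinely independent points in $(2\mathbb{N})^n$. Put $\Delta(A)=A\setminus V(A)$. For $\beta\in A$ let $g_{i,\beta}$ be the coefficient of $x^\beta$ in $g_i$ ($0$ if $\beta\notin A_i$) and $G(\mu)_\beta=-\sum_{i=0}^s\mu_ig_{i,\beta}$. For $\beta\in\Delta(A)$ let $\lambda_0^{(\beta)},\dots,\lambda_r^{(\beta)}\ge0$ be the barycentric coordinates: $\beta=\sum_j\lambda_j^{(\beta)}\alpha(j)$, $\sum_j\lambda_j^{(\beta)}=1$; let $\mathrm{nz}(\beta)=\{j:\lambda_j^{(\beta)}\ne0\}$. Let $\Delta(G(\mu))$ be the set of $\beta\in\Delta(A)$ with $G(\mu)_\beta\neq0$ and ($G(\mu)_\beta<0$ or $\beta\notin(2\mathbb{N})^n$), and $\Delta(G)=\bigcup_{\mu\in\mathbb{R}^s_{\ge0}}\Delta(G(\mu))$. ST-polynomials. $G(\mu)$ is called an ST-polynomial if its Newton polytope equals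 $\mathrm{conv}(A)$, which is a simplex with even vertices $\alpha(0),\dots,\alpha(r)$, and all its vertex coefficients are strictly positive; in the present setting this means $G(\mu)_{\alpha(j)}>0$ for all $0\le j\le r$ (including $j=0$). The bound $s(f,\mathbf g)$. For $\mu\in\mathbb{R}_{\ge0}^s$ such that $G(\mu)$ is an ST-polynomial, let $m^*(\mu)$ be the infimum of $$\sum_{\beta\in\Delta(G(\mu)),\,\lambda_0^{(\beta)}\ne0}\lambda_0^{(\beta)}|G(\mu)_\beta|^{1/\lambda_0^{(\beta)}}\prod_{j\in\mathrm{nz}(\beta),\,j\ge1}\Big(\frac{\lambda_j^{(\beta)}}{a_{\beta,j}}\Big)^{\lambda_j^{(\beta)}/\lambda_0^{(\beta)}}$$ over all $a_{\beta,j}\ge0$ ($\beta\in\Delta(G(\mu))$, $1\le j\le r$) with $a_{\beta,j}>0$ if and only if $\lambda_j^{(\beta)}>0$, such that $\sum_{\beta\in\Delta(G(\mu))}a_{\beta,j}\le G(\mu)_{\alpha(j)}$ for all $1\le j\le r$, and $|G(\mu)_\beta|\le\prod_{j\in\mathrm{nz}(\beta)}(a_{\beta,j}/\lambda_j^{(\beta)})^{\lambda_j^{(\beta)}}$ for all $\beta\in\Delta(G(\mu))$ with $\lambda_0^{(\beta)}=0$; set $G(\mu)_{\rm sonc}=G(\mu)_{\alpha(0)}-m^*(\mu)$ ($m^*(\mu)=+\infty$ if there is no feasible point). If $G(\mu)$ is not an ST-polynomial, set $G(\mu)_{\rm sonc}=-\infty$. Set $s(f,\mathbf g)=\sup\{G(\mu)_{\rm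 sonc}:\mu\in\mathbb{R}_{\ge0}^s\}$. Let $R=[0,\infty)^s\times\prod_{\beta\in\Delta(G)}(\mathbb{R}_{>0}^r\times\mathbb{R}_{\ge0})$, with elements written $(\mu,(\mathbf a_\beta,b_\beta)_{\beta\in\Delta(G)})$, $\mathbf a_\beta=(a_{\beta,1},\dots,a_{\beta,r})$. Problem (P): minimize over $R$ $$\sum_{i=1}^s\mu_ig_{i,\alpha(0)}+\sum_{\beta\in\Delta(G),\,\lambda_0^{(\beta)}\ne0}\lambda_0^{(\beta)}b_\beta^{1/\lambda_0^{(\beta)}}\prod_{j\in\mathrm{nz}(\beta),\,j\ge1}\Big(\frac{\lambda_j^{(\beta)}}{a_{\beta,j}}\Big)^{\lambda_j^{(\beta)}/\lambda_0^{(\beta)}}$$ subject to (1) $\sum_{\beta\in\Delta(G)}a_{\beta,j}\le G(\mu)_{\alpha(j)}$ for all $1\le j\le r$; (2) $\prod_{j\in\mathrm{nz}(\beta)}(a_{\beta,j}/\lambda_j^{(\beta)})^{\lambda_j^{(\beta)}}\ge b_\beta$ for all $\beta\in\Delta(G)$ with $\lambda_0^{(\beta)}=0$; (3) $|G(\mu)_\beta|\le b_\beta$ for all $\beta\in\Delta(G)$. Let $g_{i,\alpha(0)}^+=\max\{g_{i,\alpha(0)},0\}$, $G(\mu)_\beta^-=\sum_{i:\,g_{i,\beta}>0}\mu_ig_{i,\beta}$ and $G(\mu)_\beta^+=-\sum_{i:\,g_{i,\beta}<0}\mu_ig_{i,\beta}$ (sums over $0\le i\le s$). Problem (Q): minimize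 over $R$ $$\sum_{i=1}^s\mu_ig_{i,\alpha(0)}^++\sum_{\beta\in\Delta(G),\,\lambda_0^{(\beta)}\ne0}\lambda_0^{(\beta)}b_\beta^{1/\lambda_0^{(\beta)}}\prod_{j\in\mathrm{nz}(\beta),\,j\ge1}\Big(\frac{\lambda_j^{(\beta)}}{a_{\beta,j}}\Big)^{\lambda_j^{(\beta)}/\lambda_0^{(\beta)}}$$ subject to (1) and (2) of (P), together with $G(\mu)_\beta^+\le b_\beta$ and $G(\mu)_\beta^-\le b_\beta$ for all $\beta\in\Delta(G)$. Optimal values are infima; for an infeasible problem the optimal value is $+\infty$, so that the resulting bound ($f_{\alpha(0)}$ minus the optimal value) is $-\infty$.
   Formalization: In (P) and (Q) the domain requires a_{β,j} ≥ 0 with a_{β,j} > 0 iff λ_j^{(β)} > 0 (as in m* ), not a_β ∈ R_{>0}^r; literally the claim fails for f = 1+x⁴+y⁴+z⁴−2x²y²−z, g₁ = 0. ''Attained'' means s(f,g) is finite. *)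

(* Defs.v *)
From mathcomp Require Import all_boot all_order all_algebra finmap.
From mathcomp Require Import(canonicals, coercions) mpoly.
From mathcomp Require Import all_classical all_reals all_analysis.

Set Implicit Arguments.
Unset Strict Implicit.
Unset Printing Implicit Defensive.

Import Order.TTheory GRing.Theory Num.Theory.

Local Open Scope classical_set_scope.
Local Open Scope ring_scope.

(* The notations of mpoly clash with those of the analysis library, hence the
   qualified names: [mpoly.mpoly n R] is R[x_1..x_n], [mpoly.multinom n] is N^n
   and [mpoly.mcoeff m p] is the coefficient of x^m in p. *)

Definition exponent_point (R : realType) (n : nat) (m : mpoly.multinom n) :
    'rV[R]_n :=
  \row_i (mpoly.fun_of_multinom m i)%:R.

Definition even_exponent (n : nat) (m : mpoly.multinom n) : bool :=
  [forall i, ~~ odd (mpoly.fun_of_multinom m i)].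

Definition conv_hull (R : realType) (n : nat) (S : {fset mpoly.multinom n}) :
    set 'rV[R]_n :=
  [set x | exists c : mpoly.multinom n -> R,
     [/\ forall m, m \in S -> 0 <= c m,
         \sum_(m <- S) c m = 1
       & x = \sum_(m <- S) c m *: exponent_point R m]].

Arguments conv_hull R {n} S.

(* Extreme points; for a polytope these are exactly the vertices. *)
Definition vertices (R : realType) (n : nat) (C : set 'rV[R]_n) :
    set 'rV[R]_n :=
  [set x | C x /\ forall (y z : 'rV[R]_n) (t : R), C y -> C z -> 0 < t < 1 ->
     x = t *: y + (1 - t) *: z -> y = x /\ z = x].

Definition affinely_independent (R : realType) (n k : nat)
    (v : 'I_k -> 'rV[R]_n) : Prop :=
  forall c : 'I_k -> R, \sum_j c j = 0 -> \sum_j c j *: v j = 0 ->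
    forall j, c j = 0.

Definition msupport (R : realType) (n : nat) (p : mpoly.mpoly n R) :
    {fset mpoly.multinom n} :=
  [fset m in mpoly.msupp p]%fset.

Section Setting.
Context {R : realType} {n s r : nat}.
Implicit Types (mu : 'I_s -> R) (b : mpoly.multinom n).

Section Polynomials.
Variables (f : mpoly.mpoly n R) (g : 'I_s -> mpoly.mpoly n R).

(* g_0 = -f; the index i >= 1 is [lift ord0 k] with k : 'I_s. *)
Definition gfam (i : 'I_s.+1) : mpoly.mpoly n R :=
  if unlift ord0 i is Some k then g k else - f.

Definition mufam mu (i : 'I_s.+1) : R :=
  if unlift ord0 i is Some k then mu k else 1.

Definition Gpoly mu : mpoly.mpoly n R := f - \sum_i mu i *: g i.

Definition Gcoef mu b : R := mpoly.mcoeff b (Gpoly mu).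

Definition Asupp (i : 'I_s.+1) : {fset mpoly.multinom n} := msupport (gfam i).

Definition Aset : {fset mpoly.multinom n} :=
  (\bigcup_(i <- enum 'I_s.+1) Asupp i)%fset.

Definition DeltaA : {fset mpoly.multinom n} :=
  [fset b in Aset |
    ~~ `[< vertices (conv_hull R Aset) (exponent_point R b) >]]%fset.

Definition DeltaGmu mu : {fset mpoly.multinom n} :=
  [fset b in DeltaA |
    (Gcoef mu b != 0) && ((Gcoef mu b < 0) || ~~ even_exponent b)]%fset.

Definition nonneg mu : Prop := forall i, 0 <= mu i.

Definition DeltaG : {fset mpoly.multinom n} :=
  [fset b in DeltaA | `[< exists2 mu, nonneg mu & b \in DeltaGmu mu >]]%fset.

Definition Gminus mu b : R :=
  \sum_(i < s.+1 | 0 < mpoly.mcoeff b (gfam i))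
    mufam mu i * mpoly.mcoeff b (gfam i).

Definition Gplus mu b : R :=
  - \sum_(i < s.+1 | mpoly.mcoeff b (gfam i) < 0)
      mufam mu i * mpoly.mcoeff b (gfam i).

Variables (alpha : 'I_r.+1 -> mpoly.multinom n)
          (lam : mpoly.multinom n -> 'I_r.+1 -> R).

Definition barycentric b : Prop :=
  [/\ forall j, 0 <= lam b j,
      \sum_j lam b j = 1
    & exponent_point R b = \sum_j lam b j *: exponent_point R (alpha j)].

Definition is_ST mu : Prop :=
  conv_hull R (msupport (Gpoly mu)) = conv_hull R Aset /\
  forall j, 0 < Gcoef mu (alpha j).

(* The variables a_{b,j}, 1 <= j <= r, are [a b k] with j = [lift ord0 k], and
   b_b is [bb b].  Both are total functions; only their values at the exponents
   summed over matter. *)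
Implicit Types (a : mpoly.multinom n -> 'I_r -> R) (bb : mpoly.multinom n -> R).

(* The sign pattern is the same in the definition of m^* and in the domain of
   (P) and (Q): a_{b,j} vanishes when lam_j = 0, that is, when it occurs in no
   product.  Asking for a_{b,j} > 0 also there would not be harmless: for
   f = 1 + x^4 + y^4 + z^4 - 2 x^2 y^2 - z and g = 0, the sum constraints
   then exclude the tight product constraint for x^2 y^2, so that (P) would
   be infeasible although s(f,g) is finite and attained. *)
Definition sign_pattern (D : {fset mpoly.multinom n}) a : Prop :=
  forall b k, b \in D ->
    0 <= a b k /\ (0 < a b k <-> 0 < lam b (lift ord0 k)).

Definition circuit_term b (c : R) (u : 'I_r -> R) : R :=
  lam b ord0 * c `^ (lam b ord0)^-1 *
  \prod_(k < r | lam b (lift ord0 k) != 0)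
    (lam b (lift ord0 k) / u k) `^ (lam b (lift ord0 k) / lam b ord0).

(* Only used when lam_0 = 0, so that nz(b) consists of indices j >= 1. *)
Definition circuit_number b (u : 'I_r -> R) : R :=
  \prod_(k < r | lam b (lift ord0 k) != 0)
    (u k / lam b (lift ord0 k)) `^ lam b (lift ord0 k).

Definition mstar_feasible mu a : Prop :=
  [/\ sign_pattern (DeltaGmu mu) a,
      forall k, \sum_(b <- DeltaGmu mu) a b k <=
                Gcoef mu (alpha (lift ord0 k))
    & forall b, b \in DeltaGmu mu -> lam b ord0 = 0 ->
        `|Gcoef mu b| <= circuit_number b (a b)].

Definition mstar mu : \bar R :=
  ereal_inf [set (\sum_(b <- DeltaGmu mu | lam b ord0 != 0)
                    circuit_term b `|Gcoef mu b| (a b))%:E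
            | a in mstar_feasible mu].

Definition Gsonc mu : \bar R :=
  if `[< is_ST mu >] then ((Gcoef mu (alpha ord0))%:E - mstar mu)%E else -oo%E.

Definition sfg : \bar R := ereal_sup [set Gsonc mu | mu in nonneg].

Definition in_domain mu a bb : Prop :=
  [/\ nonneg mu, sign_pattern DeltaG a
    & forall b, b \in DeltaG -> 0 <= bb b].

Definition common_constraints mu a bb : Prop :=
  (forall k, \sum_(b <- DeltaG) a b k <= Gcoef mu (alpha (lift ord0 k))) /\
  (forall b, b \in DeltaG -> lam b ord0 = 0 ->
     bb b <= circuit_number b (a b)).

Definition P_feasible mu a bb : Prop :=
  [/\ in_domain mu a bb, common_constraints mu a bb
    & forall b, b \in DeltaG -> `|Gcoef mu b| <= bb b].

Definition Q_feasible mu a bb : Prop :=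
  [/\ in_domain mu a bb, common_constraints mu a bb
    & forall b, b \in DeltaG -> Gplus mu b <= bb b /\ Gminus mu b <= bb b].

Definition P_objective mu a bb : R :=
  \sum_i mu i * mpoly.mcoeff (alpha ord0) (g i) +
  \sum_(b <- DeltaG | lam b ord0 != 0) circuit_term b (bb b) (a b).

Definition Q_objective mu a bb : R :=
  \sum_i mu i * Num.max (mpoly.mcoeff (alpha ord0) (g i)) 0 +
  \sum_(b <- DeltaG | lam b ord0 != 0) circuit_term b (bb b) (a b).

Definition P_value : \bar R :=
  ereal_inf [set v | exists mu a bb,
    P_feasible mu a bb /\ v = (P_objective mu a bb)%:E].

Definition Q_value : \bar R :=
  ereal_inf [set v | exists mu a bb,
    Q_feasible mu a bb /\ v = (Q_objective mu a bb)%:E].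

End Polynomials.
End Setting.

(* Main.v *)
(** On Delta(A) the supports are disjoint, so every G(mu)_beta is a single term
and |G(mu)_beta| = max (G(mu)_beta^+, G(mu)_beta^-): (P) and (Q) have the same
feasible points, and the same objective as g_{i,alpha(0)} >= 0.  For the same
reason Delta(G(mu)) = Delta(G) whenever mu > 0, so that at the given maximizer
mu* the points admissible for m^*(mu* ) are feasible for (P); this bounds the
value of (P) from above.

Conversely, a feasible point of (P) at which G(mu) is an ST-polynomial gives at
most s(f,g).  The remaining feasible points are handled by convexity: (P) is a
convex program in (mu,a,b), so if some feasible point were strictly better than
s(f,g), a convex combination with a nearly optimal point over mu*, taken close
to the latter, would still be better and have an ST-polynomial. *)

Require Import Defs.
From mathcomp Require Import all_boot all_order all_algebra finmap.
From mathcomp Require Import(canonicals, coercions) mpoly.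
From mathcomp Require Import all_classical all_reals all_analysis.
From mathcomp Require Import ring lra.

Set Implicit Arguments.
Unset Strict Implicit.
Unset Printing Implicit Defensive.

Import Order.TTheory GRing.Theory Num.Theory.

Local Open Scope classical_set_scope.
Local Open Scope ring_scope.

(** * Concavity of weighted geometric means *)

Section WeightedGeometricMean.
Context {R : realType} {I : finType}.
Implicit Types p x y : I -> R.

(** For [y > 0] this is the tangent inequality [ln y <= y - 1]. For [y = 0] the left side is 0, or 1
    when [l = 0], where equality holds. *)
Lemma powR_le_expR (y l : R) : 0 <= y -> 0 <= l -> y `^ l <= expR (l * (y - 1)).
Proof.
rewrite le_eqVlt => /predU1P[<-|y0] l0.
  have [->|ln0] := eqVneq l 0; first by rewrite powRr0 mul0r expR0.
  by rewrite powR0// expR_ge0.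
rewrite /powR gt_eqF// ler_expR ler_wpM2l//.
by rewrite -[in ln y](subrKC 1 y) le_ln1Dx// ltrBrDr addNr.
Qed.

Lemma prod_powR (c : R) p : 0 < c -> \prod_i c `^ p i = c `^ (\sum_i p i).
Proof.
move=> c0; rewrite [RHS]/powR gt_eqF// mulr_suml expR_sum.
by apply: eq_bigr => i _; rewrite /powR gt_eqF.
Qed.

(** After division by the mean [S], each factor is at most [expR (p i * (y i / S - 1))], and these
    exponents sum to 0. *)
Lemma weighted_AM_GM p y : (forall i, 0 <= p i) -> \sum_i p i = 1 ->
  (forall i, 0 <= y i) -> \prod_i y i `^ p i <= \sum_i p i * y i.
Proof.
move=> p0 p1 y0; set S := \sum_i p i * y i.
have S0 : 0 <= S by apply: sumr_ge0 => i _; rewrite mulr_ge0.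
have [S_eq0|Sn0] := eqVneq S 0.
  have [i pi0] : exists i, p i != 0.
    apply/existsP; rewrite -negb_forall; apply/negP => /forallP p_eq0.
    have : \sum_i p i = 0 by apply: big1 => i _; exact/eqP.
    by rewrite p1 => /eqP; rewrite oner_eq0.
  have yi0 : y i = 0.
    have /eqP := S_eq0; rewrite psumr_eq0 => [/allP /(_ i)|k _]; last first.
      by rewrite mulr_ge0.
    by rewrite mem_index_enum mulf_eq0 (negbTE pi0) => /(_ isT)/eqP.
  by rewrite S_eq0 (bigD1 i)//= yi0 powR0// mul0r.
have {S0 Sn0} S0 : 0 < S by rewrite lt_neqAle eq_sym Sn0.
have -> : \prod_i y i `^ p i = S * \prod_i (y i / S) `^ p i.
  have {1}-> : S = \prod_i S `^ p i by rewrite prod_powR// p1 powRr1 ?ltW.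
  rewrite -big_split/=.
  apply: eq_bigr => i _; rewrite -powRM ?divr_ge0 ?(ltW S0)//.
  by rewrite mulrC divfK// gt_eqF.
rewrite ger_pMr//.
have : \prod_i (y i / S) `^ p i <= \prod_i expR (p i * (y i / S - 1)).
  by apply: ler_prod => i _; rewrite powR_ge0 powR_le_expR// divr_ge0// ltW.
rewrite -expR_sum; suff -> : \sum_i p i * (y i / S - 1) = 0 by rewrite expR0.
under eq_bigr do rewrite mulrBr mulr1 mulrA.
by rewrite sumrB -mulr_suml p1 divff ?subrr// gt_eqF.
Qed.

(** With [z] the combination of [x] and [y], the arithmetic-geometric inequality is applied to the
    ratios [x i / z i] and [y i / z i]. The two resulting bounds, weighted by [t] and [u], add up to
    the product for [z] times [\sum_i p i = 1]. *)
Lemma concave_weighted_GM p x y (t u : R) :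
  (forall i, 0 <= p i) -> \sum_i p i = 1 ->
  (forall i, 0 <= x i) -> (forall i, 0 <= y i) -> 0 < t -> 0 < u ->
  t * \prod_i x i `^ p i + u * \prod_i y i `^ p i <=
  \prod_i (t * x i + u * y i) `^ p i.
Proof.
move=> p0 p1 x0 y0 t0 u0; set z := fun i => t * x i + u * y i.
have z0 i : 0 <= z i by rewrite addr_ge0// mulr_ge0// ltW.
(* A zero of [z] at an index of nonzero weight is a zero of both [x] and [y], so the left side
   vanishes. Otherwise [z i = 0] only where [p i = 0], and there the factor is 1. *)
have [/existsP[i /andP[pi0 /eqP zi0]]|] :=
    boolP [exists i, (p i != 0) && (z i == 0)].
  have /andP[/eqP xi0 /eqP yi0] : (x i == 0) && (y i == 0).
    move/eqP: zi0; rewrite paddr_eq0 ?mulr_ge0 ?(ltW t0) ?(ltW u0)//.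
    by rewrite !mulf_eq0 (gt_eqF t0) (gt_eqF u0).
  rewrite (bigD1 i)//= xi0 powR0// mul0r mulr0 add0r.
  rewrite (bigD1 i)//= yi0 powR0// mul0r mulr0.
  by apply: prodr_ge0 => j _; exact: powR_ge0.
rewrite negb_exists => /forallP z_neq0.
have zpos i : p i != 0 -> 0 < z i.
  by move=> pi0; have := z_neq0 i; rewrite pi0/= lt_neqAle eq_sym z0 andbT.
have prod_le w : (forall i, 0 <= w i) ->
    \prod_i w i `^ p i <= \prod_i z i `^ p i * \sum_i p i * (w i / z i).
  move=> w0; have -> : \prod_i w i `^ p i =
      \prod_i z i `^ p i * \prod_i (w i / z i) `^ p i.
    rewrite -big_split/=; apply: eq_bigr => i _.
    have [->|pi0] := eqVneq (p i) 0; first by rewrite !powRr0 mulr1.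
    by rewrite -powRM ?divr_ge0// mulrC divfK// gt_eqF// zpos.
  rewrite ler_wpM2l//; first by apply: prodr_ge0 => j _; exact: powR_ge0.
  by apply: weighted_AM_GM => // i; rewrite divr_ge0.
apply: (@le_trans _ _ (t * (\prod_i z i `^ p i * \sum_i p i * (x i / z i)) +
  u * (\prod_i z i `^ p i * \sum_i p i * (y i / z i)))).
  by rewrite lerD// ler_wpM2l ?prod_le// ltW.
rewrite mulrCA [X in _ + X]mulrCA -mulrDr.
have zp : 0 <= \prod_i z i `^ p i by apply: prodr_ge0 => j _; exact: powR_ge0.
rewrite -[leRHS]mulr1 ler_wpM2l// !mulr_sumr -big_split/= -p1.
apply: ler_sum => i _; have [->|pi0] := eqVneq (p i) 0.
  by rewrite !mul0r !mulr0 addr0.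
rewrite le_eqVlt; apply/orP; left; apply/eqP.
have zi0 : z i != 0 by rewrite gt_eqF// zpos.
by rewrite -[RHS]mulr1 -(divff zi0) /z; ring.
Qed.

End WeightedGeometricMean.

Lemma powR_prod {R : realType} (I : finType) (P : pred I) (F : I -> R) (a : R) :
  (forall i, 0 <= F i) ->
  (\prod_(i | P i) F i) `^ a = \prod_(i | P i) F i `^ a.
Proof.
(* Nonnegativity of the partial products is carried through the induction because [powRM] asks for
   it. *)
move=> F0; suff [] : 0 <= \prod_(i | P i) F i /\
  (\prod_(i | P i) F i) `^ a = \prod_(i | P i) F i `^ a by [].
elim/big_rec2: _ => [|i x y _ [y0 <-]]; first by rewrite powR1.
by rewrite mulr_ge0 ?powRM.
Qed.

(** * Circuit numbers and circuit terms of one exponent *)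

Section Circuit.
Context {R : realType} {n r : nat}.
Variables (lam : mpoly.multinom n -> 'I_r.+1 -> R) (b : mpoly.multinom n).
Hypothesis lam_ge0 : forall j, 0 <= lam b j.
Hypothesis lam_sum : \sum_j lam b j = 1.
Implicit Types (c t : R) (u v : 'I_r -> R).

Let l0 := lam b ord0.
Let l k := lam b (lift ord0 k).

Lemma circuit_numberE u : circuit_number lam b u = \prod_k (u k / l k) `^ l k.
Proof.
rewrite /circuit_number big_mkcond/=; apply: eq_bigr => k _.
by case: eqVneq => //= e; rewrite /l e powRr0.
Qed.

Lemma circuit_number_gt0 u :
  (forall k, 0 < l k -> 0 < u k) -> 0 < circuit_number lam b u.
Proof.
move=> u0; apply: prodr_gt0 => k lk.
have {}lk : 0 < l k by rewrite lt_neqAle eq_sym lk lam_ge0.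
by rewrite powR_gt0// divr_gt0// u0.
Qed.

(** When [l0 = 0] the weights [l k] already sum to 1, so the circuit number is a weighted geometric
    mean of the [u k / l k]. *)
Lemma circuit_number_concave u v t : l0 = 0 -> 0 < t < 1 ->
  (forall k, 0 <= u k) -> (forall k, 0 <= v k) ->
  (1 - t) * circuit_number lam b u + t * circuit_number lam b v <=
  circuit_number lam b (fun k => (1 - t) * u k + t * v k).
Proof.
move=> l00 /andP[t0 t1] u0 v0; rewrite !circuit_numberE.
have l_sum : \sum_k l k = 1.
  by rewrite -lam_sum big_ord_recl -/l0 l00 add0r.
under [leRHS]eq_bigr do rewrite mulrDl -!mulrA.
by apply: concave_weighted_GM => // [k|k|k|];
  rewrite ?divr_ge0 ?subr_gt0//; exact: lam_ge0.
Qed.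

(** An extra variable [d] at the index 0, in the role of [a_0], completes the weights to total 1.
    The function is then a weighted geometric mean in [(d, u)] jointly. *)
Lemma full_circuit_number_concave (d d' : R) u v t : 0 < t < 1 ->
  0 <= d -> 0 <= d' -> (forall k, 0 <= u k) -> (forall k, 0 <= v k) ->
  (1 - t) * ((d / l0) `^ l0 * circuit_number lam b u) +
  t * ((d' / l0) `^ l0 * circuit_number lam b v) <=
  (((1 - t) * d + t * d') / l0) `^ l0 *
  circuit_number lam b (fun k => (1 - t) * u k + t * v k).
Proof.
move=> /andP[t0 t1] d0 d'0 u0 v0.
pose x (z : 'I_r -> R) (c : R) j :=
  if unlift ord0 j is Some k then z k / l k else c / l0.
have x_ge0 z c : (forall k, 0 <= z k) -> 0 <= c -> forall j, 0 <= x z c j.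
  move=> z0 c0 j; rewrite /x; case: unliftP => [k _|_];
    by apply: divr_ge0 => //; exact: lam_ge0.
have xE z c : (c / l0) `^ l0 * circuit_number lam b z =
    \prod_j x z c j `^ lam b j.
  rewrite big_ord_recl /x unlift_none circuit_numberE; congr (_ * _).
  by apply: eq_bigr => k _; rewrite liftK.
have t1' : 0 < 1 - t by rewrite subr_gt0.
rewrite !xE; apply: le_trans (concave_weighted_GM lam_ge0 lam_sum
  (x_ge0 _ _ u0 d0) (x_ge0 _ _ v0 d'0) t1' t0) _.
rewrite le_eqVlt; apply/orP; left; apply/eqP; apply: eq_bigr => j _.
by congr (_ `^ _); rewrite /x; case: unliftP => [k _|_]; ring.
Qed.

Hypothesis l0_neq0 : l0 != 0.

Let l0_gt0 : 0 < l0. Proof. by rewrite lt_neqAle eq_sym l0_neq0 lam_ge0. Qed.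

(* Only the index 0 separates the two notions, whence the circuit term is the
   least value of [a_0] for which [c] is below the full circuit number. *)
Lemma circuit_termE c u : 0 <= c -> (forall k, 0 <= u k) ->
  (forall k, 0 < l k -> 0 < u k) ->
  circuit_term lam b c u = l0 * (c / circuit_number lam b u) `^ l0^-1.
Proof.
move=> c0 u0 upos; rewrite /circuit_term -mulrA; congr (_ * _).
have cn0 := circuit_number_gt0 upos.
rewrite powRM ?invr_ge0 ?(ltW cn0)//; congr (_ * _).
rewrite -prodfV powR_prod => [|k]; last by rewrite invr_ge0 powR_ge0.
apply: eq_bigr => k _; rewrite powRrM; congr (_ `^ _).
rewrite -[X in X `^ _]invf_div -[X in X `^ _ = _]powR_inv1 ?divr_ge0//.
by rewrite -powRrM mulN1r powRN.
Qed.

Lemma circuit_term_ge0 c u : 0 <= circuit_term lam b c u.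
Proof.
rewrite /circuit_term mulr_ge0 ?mulr_ge0 ?powR_ge0//.
by apply: prodr_ge0 => k _; exact: powR_ge0.
Qed.

Lemma le_circuit_term c c' u : 0 <= c -> c <= c' ->
  circuit_term lam b c u <= circuit_term lam b c' u.
Proof.
move=> c0 cc'; rewrite /circuit_term ler_wpM2r//.
  by apply: prodr_ge0 => k _; exact: powR_ge0.
rewrite ler_wpM2l// ge0_ler_powR ?nnegrE ?invr_ge0//.
exact: le_trans cc'.
Qed.

(** Taking the circuit terms [T], [T'] as values of [a_0] makes [c], [c'] equal to the full circuit
    numbers. By concavity the combination of [c] and [c'] lies below the full circuit number at the
    combined point, so the combination of [T] and [T'] is at least the smallest admissible [a_0]
    there, which is the circuit term on the left. *)
Lemma circuit_term_convex c c' u v t : 0 < t < 1 -> 0 <= c -> 0 <= c' ->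
  (forall k, 0 <= u k) -> (forall k, 0 < l k -> 0 < u k) ->
  (forall k, 0 <= v k) -> (forall k, 0 < l k -> 0 < v k) ->
  circuit_term lam b ((1 - t) * c + t * c') (fun k => (1 - t) * u k + t * v k)
  <= (1 - t) * circuit_term lam b c u + t * circuit_term lam b c' v.
Proof.
move=> t01 c0 c'0 u0 upos v0 vpos.
have /andP[t0 t1] := t01; have t1' : 0 < 1 - t by rewrite subr_gt0.
pose w k := (1 - t) * u k + t * v k.
have w0 k : 0 <= w k by rewrite addr_ge0// mulr_ge0// ltW.
have wpos k : 0 < l k -> 0 < w k.
  by move=> lk; rewrite addr_gt0// mulr_gt0 ?upos ?vpos.
have cw0 : 0 <= (1 - t) * c + t * c' by rewrite addr_ge0// mulr_ge0// ltW.
pose T := circuit_term lam b c u; pose T' := circuit_term lam b c' v.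
have T0 : 0 <= T := circuit_term_ge0 c u.
have T'0 : 0 <= T' := circuit_term_ge0 c' v.
have inv d z : 0 <= d -> (forall k, 0 <= z k) ->
    (forall k, 0 < l k -> 0 < z k) ->
    d = (circuit_term lam b d z / l0) `^ l0 * circuit_number lam b z.
  move=> d0 z0 zpos; rewrite circuit_termE// [l0 * _]mulrC mulfK//.
  have cn0 := circuit_number_gt0 zpos.
  by rewrite -powRrM mulVf// powRr1 ?divfK ?divr_ge0 ?gt_eqF// ltW.
rewrite [leLHS]circuit_termE// -[leRHS](divfK l0_neq0) mulrC.
rewrite ler_wpM2r ?(ltW l0_gt0)//; set W := ((1 - t) * T + t * T') / l0.
have W0 : 0 <= W.
  by apply: divr_ge0; [apply: addr_ge0; apply: mulr_ge0 => //|]; exact: ltW.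
have cn0 := circuit_number_gt0 wpos.
(* Both sides become powers with exponent [l0^-1], so only their bases remain to be compared. *)
have -> : W = (W `^ l0) `^ l0^-1 by rewrite -powRrM divff ?powRr1.
have l0i : 0 <= l0^-1 by rewrite invr_ge0 ltW.
apply: ge0_ler_powR; rewrite ?nnegrE ?powR_ge0 ?divr_ge0 ?(ltW cn0)//.
rewrite ler_pdivrMr// {1}(inv c u)// {1}(inv c' v)// -/T -/T'.
exact: full_circuit_number_concave.
Qed.

End Circuit.

(** * Convex hulls of finite sets of exponents *)

Section ConvexHull.
Context {R : realType} {n : nat}.
Implicit Types S T : {fset mpoly.multinom n}.

Lemma conv_hull_exponent S m : m \in S -> conv_hull R S (exponent_point R m).
Proof.
move=> mS; exists (fun k => (k == m)%:R); split.
- by move=> k _; exact: ler0n.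
- rewrite (big_fsetD1 m)//= eqxx big1_seq ?addr0// => k /andP[_].
  by rewrite in_fsetD1 => /andP[/negbTE ->].
- rewrite (big_fsetD1 m)//= eqxx scale1r big1_seq ?addr0// => k /andP[_].
  by rewrite in_fsetD1 => /andP[/negbTE -> _]; rewrite scale0r.
Qed.

(** The weights compose: the coefficient of [m] is the [c]-average of its coefficients in the [x i].
    Indexing by a sequence covers both combinations over a finite set of exponents and combinations
    of the vertices [alpha j]. *)
Lemma conv_hull_comb S (I : eqType) (s : seq I) (c : I -> R)
    (x : I -> 'rV[R]_n) :
  (forall i, i \in s -> 0 <= c i) -> \sum_(i <- s) c i = 1 ->
  (forall i, i \in s -> conv_hull R S (x i)) ->
  conv_hull R S (\sum_(i <- s) c i *: x i).
Proof.
move=> c0 c1 xS.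
have /choice[d dP] : forall i, exists d : mpoly.multinom n -> R, i \in s ->
    [/\ forall m, m \in S -> 0 <= d m, \sum_(m <- S) d m = 1
      & x i = \sum_(m <- S) d m *: exponent_point R m].
  move=> i; have [/xS[d dP]|_] := boolP (i \in s); first by exists d.
  by exists (fun=> 0).
exists (fun m => \sum_(i <- s) c i * d i m); split.
- move=> m mS; rewrite big_seq; apply: sumr_ge0 => i si.
  by have [d0 _ _] := dP _ si; rewrite mulr_ge0 ?c0 ?d0.
- rewrite exchange_big/= -c1; apply: eq_big_seq => i si.
  by have [_ d1 _] := dP _ si; rewrite -mulr_sumr d1 mulr1.
- under [RHS]eq_bigr do rewrite scaler_suml.
  rewrite exchange_big/=; apply: eq_big_seq => i si.
  have [_ _ ->] := dP _ si; rewrite scaler_sumr.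
  by apply: eq_bigr => m _; rewrite scalerA.
Qed.

Lemma conv_hull_min S T :
  (forall m, m \in S -> conv_hull R T (exponent_point R m)) ->
  conv_hull R S `<=` conv_hull R T.
Proof. by move=> ST x [c [c0 c1 ->]]; exact: conv_hull_comb. Qed.

End ConvexHull.

(** * Coefficients and supports of G(mu) *)

Section Lagrangian.
Context {R : realType} {n s r : nat}.
Variables (f : mpoly.mpoly n R) (g : 'I_s -> mpoly.mpoly n R).
Implicit Types (mu : 'I_s -> R) (b : mpoly.multinom n).

Lemma GcoefE mu b : Gcoef f g mu b =
  mpoly.mcoeff b f - \sum_i mu i * mpoly.mcoeff b (g i).
Proof.
rewrite /Gcoef /Gpoly mpoly.mcoeffB raddf_sum; congr (_ - _).
by apply: eq_bigr => i _; rewrite /= mpoly.mcoeffZ.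
Qed.

Lemma Gcoef_gfam mu b : Gcoef f g mu b =
  - \sum_i mufam mu i * mpoly.mcoeff b (gfam f g i).
Proof.
rewrite GcoefE big_ord_recl /mufam /gfam unlift_none mul1r mpoly.mcoeffN.
rewrite opprD opprK; congr (_ - _).
by apply: eq_bigr => i _; rewrite liftK.
Qed.

Lemma Gcoef_convex mu mu' t b :
  Gcoef f g (fun i => (1 - t) * mu i + t * mu' i) b =
  (1 - t) * Gcoef f g mu b + t * Gcoef f g mu' b.
Proof.
rewrite !GcoefE.
have -> : \sum_i ((1 - t) * mu i + t * mu' i) * mpoly.mcoeff b (g i) =
    (1 - t) * \sum_i mu i * mpoly.mcoeff b (g i) +
    t * \sum_i mu' i * mpoly.mcoeff b (g i).
  rewrite !mulr_sumr -big_split/=; apply: eq_bigr => i _.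
  by rewrite mulrDl !mulrA.
by ring.
Qed.

Lemma in_Asupp i b :
  (b \in Asupp f g i) = (mpoly.mcoeff b (gfam f g i) != 0).
Proof. by rewrite /Asupp /msupport in_fset -mpoly.mcoeff_msupp. Qed.

Lemma in_Aset b :
  reflect (exists i, mpoly.mcoeff b (gfam f g i) != 0) (b \in Aset f g).
Proof.
apply: (iffP idP).
  by move=> /bigfcupP[i _]; rewrite in_Asupp; exists i.
move=> [i bi]; apply/bigfcupP; exists i; last by rewrite in_Asupp.
by rewrite mem_enum.
Qed.

Lemma in_msupport_Gpoly mu b :
  (b \in msupport (Gpoly f g mu)) = (Gcoef f g mu b != 0).
Proof. by rewrite /msupport in_fset -mpoly.mcoeff_msupp. Qed.

Lemma in_DeltaA b : (b \in DeltaA f g) = (b \in Aset f g) &&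
  ~~ `[< vertices (conv_hull R (Aset f g)) (exponent_point R b) >].
Proof. exact: in_fset. Qed.

Lemma in_DeltaGmu mu b : (b \in DeltaGmu f g mu) = [&& b \in DeltaA f g,
  Gcoef f g mu b != 0 & (Gcoef f g mu b < 0) || ~~ even_exponent b].
Proof. exact: in_fset. Qed.

Lemma in_DeltaG b : (b \in DeltaG f g) = (b \in DeltaA f g) &&
  `[< exists2 mu, nonneg mu & b \in DeltaGmu f g mu >].
Proof. exact: in_fset. Qed.

Lemma DeltaG_sub b : b \in DeltaG f g -> b \in DeltaA f g.
Proof. by rewrite in_DeltaG => /andP[]. Qed.

Lemma DeltaGmu_sub mu : nonneg mu -> (DeltaGmu f g mu `<=` DeltaG f g)%fset.
Proof.
move=> mu0; apply/fsubsetP => b bmu; rewrite in_DeltaG.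
apply/andP; split; last by apply/asboolP; exists mu.
by move: bmu; rewrite in_DeltaGmu => /andP[].
Qed.

Section ST.
Variables (alpha : 'I_r.+1 -> mpoly.multinom n)
          (lam : mpoly.multinom n -> 'I_r.+1 -> R).
Hypothesis vertices_alpha : vertices (conv_hull R (Aset f g)) =
  range (fun j => exponent_point R (alpha j)).
Hypothesis lam_bary : forall b, b \in DeltaA f g -> barycentric alpha lam b.

(** Positive vertex coefficients put every [alpha j] in the support of G(mu). Any other exponent of
    A is a convex combination of the [alpha j] through [lam], so the Newton polytope is already all
    of conv(A). Conversely, every exponent of G(mu) occurs in some [gfam f g i]. *)
Lemma is_STP mu :
  is_ST f g alpha mu <-> forall j, 0 < Gcoef f g mu (alpha j).
Proof.
split=> [[]//|G0]; split=> //; apply/seteqP; split; apply: conv_hull_min => m.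
  rewrite in_msupport_Gpoly => Gm; apply/conv_hull_exponent/in_Aset.
  apply: contrapT => g0; move: Gm.
  rewrite Gcoef_gfam big1 ?oppr0 ?eqxx// => i _.
  have [->|gi] := eqVneq (mpoly.mcoeff m (gfam f g i)) 0.
    by rewrite mulr0.
  by case: g0; exists i.
have alpha_in j :
    conv_hull R (msupport (Gpoly f g mu)) (exponent_point R (alpha j)).
  by apply: conv_hull_exponent; rewrite in_msupport_Gpoly gt_eqF.
have [/lam_bary[lam0 lam1 ->] _|] := boolP (m \in DeltaA f g).
  by apply: conv_hull_comb.
rewrite in_DeltaA => + mA; rewrite mA/= negbK => /asboolP.
by rewrite vertices_alpha => -[j _ <-].
Qed.

End ST.

(** * Consequences of disjoint supports on Delta(A) *)

Section DisjointSupports.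
Hypothesis disjoint_supports : forall i l : 'I_s.+1, (i < l)%N ->
  (DeltaA f g `&` Asupp f g i `&` Asupp f g l = fset0)%fset.

Lemma DeltaA_single b : b \in DeltaA f g ->
  exists i, mpoly.mcoeff b (gfam f g i) != 0 /\
    forall l, l != i -> mpoly.mcoeff b (gfam f g l) = 0.
Proof.
move=> bD; have := bD; rewrite in_DeltaA => /andP[/in_Aset[i bi] _].
exists i; split=> // l li.
apply/eqP/negPn/negP => bl.
have noboth (j k : 'I_s.+1) : (j < k)%N -> b \in Asupp f g j ->
    b \in Asupp f g k -> False.
  move=> /disjoint_supports/fsetP/(_ b) + bj bk.
  by rewrite in_fset0 !in_fsetI bD bj bk.
have := li; rewrite -(inj_eq val_inj) neq_ltn.
by case/orP => /noboth; apply; rewrite in_Asupp.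
Qed.

Lemma Gcoef_single mu b i :
  (forall l, l != i -> mpoly.mcoeff b (gfam f g l) = 0) ->
  Gcoef f g mu b = - (mufam mu i * mpoly.mcoeff b (gfam f g i)).
Proof.
move=> bl; rewrite Gcoef_gfam (bigD1 i)//= big1 ?addr0// => l li.
by rewrite bl ?mulr0.
Qed.

Lemma mufam_ge0 mu i : nonneg mu -> 0 <= mufam mu i.
Proof. by move=> mu0; rewrite /mufam; case: unlift. Qed.

Lemma mufam_gt0 mu i : (forall k, 0 < mu k) -> 0 < mufam mu i.
Proof. by move=> mu0; rewrite /mufam; case: unlift. Qed.

(** On Delta(A) the coefficient of G(mu) is one term [- (mufam mu i * c)]. If it is nonzero for some
    nonnegative [nu], then [mufam nu i > 0], and its sign depends on [c] alone, hence is the same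
    for every positive [mu]. *)
Lemma DeltaGmu_pos mu : (forall i, 0 < mu i) -> DeltaGmu f g mu = DeltaG f g.
Proof.
move=> mu0; apply/eqP; rewrite eqEfsubset; apply/andP; split.
  by apply: DeltaGmu_sub => i; exact: ltW.
apply/fsubsetP => b; rewrite in_DeltaG => /andP[bD /asboolP[nu nu0]].
rewrite !in_DeltaGmu bD/=; have [i [bi bl]] := DeltaA_single bD.
rewrite !(Gcoef_single _ bl) !oppr_eq0 !mulf_eq0 !negb_or !oppr_lt0.
rewrite bi !andbT (gt_eqF (mufam_gt0 i mu0))/= => /andP[nui].
have nui0 : 0 < mufam nu i by rewrite lt_neqAle eq_sym nui mufam_ge0.
by rewrite (pmulr_rgt0 _ nui0) (pmulr_rgt0 _ (mufam_gt0 i mu0)).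
Qed.

(** According to the sign of the single coefficient, one of [Gplus] and [Gminus] is the absolute
    value and the other is an empty sum, which is at most [c] as [0 <= c]. *)
Lemma Gplus_Gminus_le mu b c : b \in DeltaA f g -> nonneg mu -> 0 <= c ->
  (Gplus f g mu b <= c /\ Gminus f g mu b <= c) <-> `|Gcoef f g mu b| <= c.
Proof.
move=> bD mu0 c0; have [i [bi bl]] := DeltaA_single bD.
rewrite (Gcoef_single _ bl) normrN /Gplus /Gminus big_mkcond.
rewrite [X in _ /\ X <= _]big_mkcond (bigD1 i)//= big1 => [|l li]; last first.
  by rewrite bl// ltxx.
rewrite addr0 (bigD1 i)//= big1 => [|l li]; last by rewrite bl// ltxx.
have mui := mufam_ge0 i mu0; rewrite addr0 normrM (ger0_norm mui).
case: ltgtP bi => // bi _.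
- by rewrite ltr0_norm// mulrN; split=> [[]|].
- by rewrite gtr0_norm// oppr0; split=> [[]|].
Qed.

End DisjointSupports.
End Lagrangian.

(** * The programs (P) and (Q) and the bound s(f,g) *)

Section Programs.
Context {R : realType} {n s r : nat}.
Variables (f : mpoly.mpoly n R) (g : 'I_s -> mpoly.mpoly n R)
  (alpha : 'I_r.+1 -> mpoly.multinom n)
  (lam : mpoly.multinom n -> 'I_r.+1 -> R).
Hypothesis vertices_alpha : vertices (conv_hull R (Aset f g)) =
  range (fun j => exponent_point R (alpha j)).
Hypothesis lam_bary : forall b, b \in DeltaA f g -> barycentric alpha lam b.
Implicit Types (mu : 'I_s -> R) (b : mpoly.multinom n)
  (a : mpoly.multinom n -> 'I_r -> R) (bb : mpoly.multinom n -> R).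

Let f0 := mpoly.mcoeff (alpha ord0) f.

Lemma Q_valueE : (forall i l : 'I_s.+1, (i < l)%N ->
    (DeltaA f g `&` Asupp f g i `&` Asupp f g l = fset0)%fset) ->
  (forall i : 'I_s, 0 <= mpoly.mcoeff (alpha ord0) (g i)) ->
  Q_value f g alpha lam = P_value f g alpha lam.
Proof.
move=> disj g0; congr ereal_inf; apply/seteqP.
have objE mu a bb :
    Q_objective f g alpha lam mu a bb = P_objective f g alpha lam mu a bb.
  by congr (_ + _); apply: eq_bigr => i _; rewrite max_l.
split=> _ [mu [a [bb [[[mu0 sa bb0] cc h] ->]]]]; exists mu, a, bb;
  rewrite objE; split=> //; split=> // b bD.
- by apply/Gplus_Gminus_le; [|exact: DeltaG_sub| |exact: bb0|exact: h].
- by apply/Gplus_Gminus_le; [|exact: DeltaG_sub| |exact: bb0|exact: h].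
Qed.

(** Restricted to Delta(G(mu)), the same [a] is feasible for [mstar]. Passing from the objective of
    (P) to that of [mstar] drops nonnegative terms and replaces [bb b] by the smaller
    [|Gcoef f g mu b|], so the circuit sum can only decrease. *)
Lemma P_objective_le_sfg mu a bb : (forall j, 0 < Gcoef f g mu (alpha j)) ->
  P_feasible f g alpha lam mu a bb ->
  ((f0 - P_objective f g alpha lam mu a bb)%:E <= sfg f g alpha lam)%E.
Proof.
move=> Gpos [[mu0 sa bb0] [ca cc] hb].
have sub b : b \in DeltaGmu f g mu -> b \in DeltaG f g.
  exact/fsubsetP/DeltaGmu_sub.
have sum_sub (F : mpoly.multinom n -> R) (P : pred (mpoly.multinom n)) :
    (forall b, b \in DeltaG f g -> P b -> 0 <= F b) ->
    \sum_(b <- DeltaGmu f g mu | P b) F b <= \sum_(b <- DeltaG f g | P b) F b.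
  move=> F0; rewrite [leRHS](big_fsetIDcond _ (mem (DeltaGmu f g mu)))/=.
  have -> : [fset b in DeltaG f g | b \in DeltaGmu f g mu]%fset =
      DeltaGmu f g mu.
    apply/fsetP => b; rewrite in_fset/=.
    by apply/andP/idP => [[]//|bmu]; split=> //; exact: sub.
  rewrite lerDl big_seq_cond; apply: sumr_ge0 => b /andP[].
  by rewrite in_fset => /andP[bD _]; exact: F0.
have feas : mstar_feasible f g alpha lam mu a.
  split.
  - by move=> b k /sub; exact: sa.
  - move=> k; apply: le_trans (ca k); apply: sum_sub => b bD _.
    by have [] := sa b k bD.
  - by move=> b /sub bD l0; apply: le_trans (hb b bD) (cc b bD l0).
apply: le_trans (ereal_sup_ubound _); last by exists mu; [exact: mu0|].
rewrite /Gsonc asboolT; last exact/(is_STP vertices_alpha lam_bary).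
have le_mstar : (mstar f g alpha lam mu <=
    (\sum_(b <- DeltaG f g | lam b ord0 != 0) circuit_term lam b (bb b) (a b))%:E)%E.
  apply: ge_ereal_inf; eexists; first by exists a; [exact: feas|reflexivity].
  rewrite lee_fin; apply: le_trans (sum_sub _ _ _) _ => [b bD _|].
    by apply: circuit_term_ge0; have [] := lam_bary (DeltaG_sub bD).
  rewrite big_seq_cond [leRHS]big_seq_cond; apply: ler_sum => b /andP[bD _].
  by apply: le_circuit_term; [have [] := lam_bary (DeltaG_sub bD)| |exact: hb].
apply: le_trans (leeB (lexx _) le_mstar).
rewrite -EFinB lee_fin GcoefE /P_objective /f0.
by rewrite opprD addrA.
Qed.

(** * Convexity of (P) *)

Section Convexity.
Variables (mu mu' : 'I_s -> R) (a a' : mpoly.multinom n -> 'I_r -> R)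
  (bb bb' : mpoly.multinom n -> R) (t : R).
Hypothesis t01 : 0 < t < 1.
Hypotheses (feas : P_feasible f g alpha lam mu a bb)
           (feas' : P_feasible f g alpha lam mu' a' bb').

Let mu_t i := (1 - t) * mu i + t * mu' i.
Let a_t b k := (1 - t) * a b k + t * a' b k.
Let bb_t b := (1 - t) * bb b + t * bb' b.

Let t0 : 0 < t. Proof. by case/andP: t01. Qed.
Let t1 : 0 < 1 - t. Proof. by rewrite subr_gt0; case/andP: t01. Qed.

Let comb_ge0 (x y : R) : 0 <= x -> 0 <= y -> 0 <= (1 - t) * x + t * y.
Proof. by move=> x0 y0; rewrite addr_ge0// mulr_ge0// ltW. Qed.

Let comb_le (x y x' y' : R) : x <= x' -> y <= y' ->
  (1 - t) * x + t * y <= (1 - t) * x' + t * y'.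
Proof. by move=> xx' yy'; rewrite lerD// ler_wpM2l// ltW. Qed.

Lemma P_feasible_convex : P_feasible f g alpha lam mu_t a_t bb_t.
Proof.
have [[mu0 sa bb0] [ca cc] hb] := feas.
have [[mu0' sa' bb0'] [ca' cc'] hb'] := feas'.
split; first split.
- by move=> i; exact: comb_ge0.
- move=> b k bD; have [ak akP] := sa b k bD; have [ak' akP'] := sa' b k bD.
  split; first exact: comb_ge0.
  split=> [|lk]; last by rewrite addr_gt0// mulr_gt0// ?akP ?akP'.
  (* If [lam] is not positive at [k], neither point has a positive entry there, so the combination
     cannot have one either. *)
  case: (ltP 0 (lam b (lift ord0 k))) => // lk.
  have nak : a b k <= 0 by rewrite leNgt; apply/negP => /akP; rewrite ltNge lk.
  have nak' : a' b k <= 0.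
    by rewrite leNgt; apply/negP => /akP'; rewrite ltNge lk.
  by have := comb_le nak nak'; rewrite !mulr0 addr0 leNgt => /negbTE ->.
- by move=> b bD; apply: comb_ge0; [exact: bb0|exact: bb0'].
- split=> [k|b bD l0].
    rewrite Gcoef_convex big_split/= -!mulr_sumr.
    exact: comb_le.
  have [lam0 lam1 _] := lam_bary (DeltaG_sub bD).
  apply: le_trans (circuit_number_concave lam0 lam1 l0 t01 _ _) => [|k|k].
  + by apply: comb_le; [exact: cc|exact: cc'].
  + by have [] := sa b k bD.
  + by have [] := sa' b k bD.
- move=> b bD; rewrite Gcoef_convex; apply: le_trans (ler_normD _ _) _.
  rewrite !normrM (gtr0_norm t0) (gtr0_norm t1).
  by apply: comb_le; [exact: hb|exact: hb'].
Qed.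

(** The part in [mu] is linear, and each circuit term is jointly convex in [(bb b, a b)]. *)
Lemma P_objective_convex : P_objective f g alpha lam mu_t a_t bb_t <=
  (1 - t) * P_objective f g alpha lam mu a bb +
  t * P_objective f g alpha lam mu' a' bb'.
Proof.
have [[mu0 sa bb0] [ca cc] hb] := feas.
have [[mu0' sa' bb0'] [ca' cc'] hb'] := feas'.
rewrite /P_objective !mulrDr addrACA lerD//.
  rewrite !mulr_sumr -big_split/=; apply: ler_sum => i _.
  by rewrite /mu_t mulrDl !mulrA.
rewrite !mulr_sumr -big_split/= big_seq_cond [leRHS]big_seq_cond.
apply: ler_sum => b /andP[bD l0].
have [lam0 lam1 _] := lam_bary (DeltaG_sub bD).
apply: circuit_term_convex => //.
- exact: bb0.
- exact: bb0'.
- by move=> k; have [] := sa b k bD.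
- by move=> k lk; apply/(proj2 (sa b k bD)).
- by move=> k; have [] := sa' b k bD.
- by move=> k lk; apply/(proj2 (sa' b k bD)).
Qed.

End Convexity.
End Programs.

(** * Comparison of the value of (P) with s(f,g) *)

Theorem theorem3p5 (R : realType) (n s r : nat)
    (f : mpoly.mpoly n R) (g : 'I_s -> mpoly.mpoly n R)
    (alpha : 'I_r.+1 -> mpoly.multinom n)
    (lam : mpoly.multinom n -> 'I_r.+1 -> R)
    (vertices_alpha :
      vertices (conv_hull R (Aset f g)) =
      range (fun j => exponent_point R (alpha j)))
    (alpha_indep : affinely_independent (fun j => exponent_point R (alpha j)))
    (alpha_even : forall j, even_exponent (alpha j))
    (lam_bary : forall b, b \in DeltaA f g -> barycentric alpha lam b)
    (one_negative : forall j : 'I_r.+1, (1 <= j)%N ->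
      exists! i : 'I_s.+1, mpoly.mcoeff (alpha j) (gfam f g i) < 0)
    (g_alpha0 : forall i : 'I_s, 0 <= mpoly.mcoeff (alpha ord0) (g i))
    (disjoint_supports : forall i l : 'I_s.+1, (i < l)%N ->
      (DeltaA f g `&` Asupp f g i `&` Asupp f g l = fset0)%fset)
    (attained : exists mu : 'I_s -> R,
      [/\ forall i, 0 < mu i,
          Gsonc f g alpha lam mu = sfg f g alpha lam
        & sfg f g alpha lam \is a fin_num]) :
  ((mpoly.mcoeff (alpha ord0) f)%:E - Q_value f g alpha lam =
   (mpoly.mcoeff (alpha ord0) f)%:E - P_value f g alpha lam)%E /\
  ((mpoly.mcoeff (alpha ord0) f)%:E - P_value f g alpha lam =
   sfg f g alpha lam)%E.
Proof.
rewrite Q_valueE//; split=> //.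
have {attained} [mu [mu0 mu_opt sfg_fin]] := attained.
set f0 := mpoly.mcoeff (alpha ord0) f.
have mu_ge0 : nonneg mu by move=> i; exact: ltW.
have DE := DeltaGmu_pos disjoint_supports mu0.
have : is_ST f g alpha mu.
  (* Outside the ST case [Gsonc] is [-oo], against the finiteness of the attained supremum. *)
  apply: contrapT => nST; move: sfg_fin; rewrite -mu_opt /Gsonc.
  by rewrite asboolF.
move=> /(is_STP vertices_alpha lam_bary) Gpos.
set sigma := fine (sfg f g alpha lam).
have sfgE : sfg f g alpha lam = sigma%:E by rewrite fineK.
(* [K] is the sum of the [mu i * g_{i,alpha(0)}], the part of the objective of (P) that depends on
   [mu] alone. Solving [Gsonc = sigma] for [mstar] then gives [f0 - sigma - K]. *)
pose K := f0 - Gcoef f g mu (alpha ord0).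
have mstarE : mstar f g alpha lam mu = (f0 - sigma - K)%:E.
  move: mu_opt; rewrite /Gsonc asboolT; last first.
    exact/(is_STP vertices_alpha lam_bary).
  rewrite sfgE; case: mstar => //= m [<-]; rewrite /K; congr (_%:E); ring.
(* The least values that the third constraint of (P) allows. As Delta(G) = Delta(G(mu)), the other
   constraints become those of [mstar]. *)
pose bbs b := `|Gcoef f g mu b|.
have feasP a : mstar_feasible f g alpha lam mu a ->
    P_feasible f g alpha lam mu a bbs.
  case; rewrite DE => sa ca cc; split=> //; split=> //.
  by move=> b _; exact: normr_ge0.
have objE a : P_objective f g alpha lam mu a bbs =
    K + \sum_(b <- DeltaGmu f g mu | lam b ord0 != 0)
      circuit_term lam b `|Gcoef f g mu b| (a b).
  by rewrite /P_objective DE /K GcoefE subKr.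
suff -> : P_value f g alpha lam = (f0 - sigma)%:E.
  by rewrite sfgE -EFinB subKr.
(* The infimum [mstar] may fail to be attained, so points over [mu] are only taken optimal up to
   [e]. *)
have near_opt e : 0 < e -> exists a, P_feasible f g alpha lam mu a bbs /\
    P_objective f g alpha lam mu a bbs < f0 - sigma + e.
  move=> e0.
  have mstar_fin : mstar f g alpha lam mu \is a fin_num by rewrite mstarE.
  have [_ [a fa <-]] := lb_ereal_inf_adherent e0 mstar_fin.
  rewrite -/(mstar _ _ _ _ _) mstarE -EFinD lte_fin => lt_a.
  exists a; split; first exact: feasP.
  by rewrite objE; lra.
apply/eqP; rewrite eq_le; apply/andP; split.
  apply/lee_addgt0Pr => e e0; have [a [fa lt_a]] := near_opt _ e0.
  apply: le_trans (ereal_inf_lbound _) _; first by exists mu, a, bbs; split.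
  by rewrite -EFinD lee_fin ltW.
apply: le_ereal_inf_tmp => _ [nu [a [bb [fa ->]]]].
rewrite lee_fin leNgt; apply/negP => lt_nu.
(* A convex combination close enough to [mu] keeps the coefficient at
   [alpha 0] positive; those at the other vertices are nonnegative at [nu]. *)
pose G0 := Gcoef f g mu (alpha ord0); pose Gn := Gcoef f g nu (alpha ord0).
have G0_gt0 : 0 < G0 by exact: Gpos.
(* This choice gives [(1 - t) * G0 - t * |Gn| = t > 0], a lower bound for the combined coefficient
   at [alpha ord0]. *)
pose t := G0 / (G0 + `|Gn| + 1).
have den0 : 0 < G0 + `|Gn| + 1 by rewrite addr_gt0// ltr_wpDr.
have tE : t * (G0 + `|Gn| + 1) = G0 by rewrite divfK// gt_eqF.
have t0 : 0 < t by rewrite divr_gt0.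
have t1 : t < 1 by rewrite ltr_pdivrMr// mul1r -addrA ltrDl ltr_wpDl.
have t01 : 0 < t < 1 by rewrite t0.
set obj := P_objective _ _ _ _ _ _ _ in lt_nu.
(* With this error the combined objective is below [(1 - t) * (f0 - sigma + e) + t * obj = f0 -
   sigma - t * e], whereas the combination has an ST-polynomial and so its objective is at least
   [f0 - sigma]. *)
pose e := t * (f0 - sigma - obj).
have e0 : 0 < e by rewrite mulr_gt0// subr_gt0.
have [a' [fa' lt_a']] := near_opt _ e0.
have Gt_gt0 j : 0 < Gcoef f g (fun i => (1 - t) * mu i + t * nu i) (alpha j).
  rewrite Gcoef_convex; have [k ->|->] := unliftP ord0 j.
    rewrite ltr_wpDr ?mulr_gt0 ?subr_gt0//.
    have [[_ sa _] [ca _] _] := fa; rewrite mulr_ge0 ?(ltW t0)//.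
    apply: le_trans (ca k); rewrite big_seq; apply: sumr_ge0 => b bD.
    by have [] := sa b k bD.
  rewrite -/G0 -/Gn; have : - (t * `|Gn|) <= t * Gn.
    by rewrite -mulrN ler_pM2l// lerNl ler_normr lexx orbT.
  by lra.
have := P_objective_le_sfg vertices_alpha lam_bary Gt_gt0
  (P_feasible_convex lam_bary t01 fa' fa).
rewrite sfgE lee_fin -/f0.
have := P_objective_convex lam_bary t01 fa' fa; rewrite -/obj.
set om := P_objective _ _ _ _ _ _ _.
set oa := P_objective _ _ _ _ _ _ _ => hc hs.
have : (1 - t) * oa < (1 - t) * (f0 - sigma + e) by rewrite ltr_pM2l ?subr_gt0.
have : 0 < t * e by rewrite mulr_gt0.
rewrite /e; lra.
Qed.
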